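(* Let $\mathbb F\in\{\mathbb R,\mathbb C\}$ and $A,B\in M_n(\mathbb F)$ with $\|A+B\|_2<\|A\|_2+\|B\|_2$. Then $\mathcal M_{\mathbb F}(\exp(A)\exp(B))<\|A\|_2+\|B\|_2$.
   Context: $\|\cdot\|_2$ is the operator norm. For $\mathbb F\in\{\mathbb R,\mathbb C\}$ and $A\in M_n(\mathbb F)$, the Magnus exponent is $\mathcal M_{\mathbb F}(A)=\inf\{\sum_{i=1}^k\|B_i\|_2 : k\ge1,\ B_i\in M_n(\mathbb F),\ \exp(B_k)\cdots\exp(B_1)=A\}$. *)

(* Defs.v *)
From HB Require Import structures.
From mathcomp Require Import all_boot all_order all_algebra.
From mathcomp Require Import all_classical all_reals topology normedtype sequences.
From mathcomp Require Import complex.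
Set Implicit Arguments. Unset Strict Implicit. Unset Printing Implicit Defensive.
Import Order.TTheory GRing.Theory Num.Theory.
Import numFieldNormedType.Exports.
Local Open Scope classical_set_scope.
Local Open Scope ring_scope.

(* The scalar field is K (either R or R[i]); ab : K -> R is its absolute value. *)
Section Defs.
Variables (R : realType) (K : numFieldType) (ab : K -> R).

Definition vnorm2 (n : nat) (x : 'cV[K]_n) : R :=
  Num.sqrt (\sum_(i < n) ab (x i ord0) ^+ 2).

Definition opnorm2 (n : nat) (A : 'M[K]_n) : R :=
  sup [set vnorm2 (A *m x) | x in [set x : 'cV[K]_n | vnorm2 x <= 1]].

Definition mexp (n : nat) (B : 'M[K]_n) : 'M[K]_n :=
  \matrix_(i, j) lim ((fun N : nat =>
      (\sum_(k < N) ((k`!%:R)^-1 *: (B ^+ k))) i j) @ \oo).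

(* Magnus exponent: inf of sum_i ||B_i||_2 over k >= 1 and B_1..B_k with
   exp(B_k) ... exp(B_1) = A.  Here k = m.+1, B_{i+1} = Bs i. *)
Definition magnus (n : nat) (A : 'M[K]_n) : R :=
  inf [set s : R | exists (m : nat) (Bs : 'I_m.+1 -> 'M[K]_n),
        \big[mulmx/1%:M]_(i < m.+1) mexp (Bs (rev_ord i)) = A /\
        s = \sum_(i < m.+1) opnorm2 (Bs i)].
End Defs.

Definition abR (R : realType) (x : R) : R := `|x|.
Definition abC (R : realType) (z : R[i]) : R := ComplexField.Normc.normc z.

(* Main.v *)
(* For t > 0 write exp(A) exp(B) = exp((1-t)A) [exp(tA) exp(tB)] exp((1-t)B).
   For small t the bracket is exp(Z) with Z = t(A+B) + O(t^2), so the Magnus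
   exponent is at most (1-t)(|A|+|B|) + t|A+B| + O(t^2), which is less than
   |A|+|B| for small t.  The logarithm Z is obtained as the fixed point of the
   contraction X |-> 1 + E - (exp(X) - X), where 1 + E is the bracket.  The
   argument is uniform in the scalar field, of which only the properties
   collected in [complete_abs] matter. *)
Require Import Defs.
From HB Require Import structures.
From mathcomp Require Import all_boot all_order all_algebra.
From mathcomp Require Import all_classical all_reals topology normedtype sequences.
From mathcomp Require Import complex.
From mathcomp Require Import exp ring lra.
Import Order.TTheory GRing.Theory Num.Theory.
Import numFieldNormedType.Exports.
Local Open Scope ring_scope.
Local Open Scope classical_set_scope.
Set Implicit Arguments.
Unset Strict Implicit.
Unset Printing Implicit Defensive.

(* [ab_small] says that the topology induced by [ab] refines the one in which
   the limits of [mexp] are taken. *)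
Record complete_abs (R : realType) (K : numFieldType) (ab : K -> R) : Prop := {
  ab_ge0 : forall x, 0 <= ab x;
  abM : {morph ab : x y / x * y};
  abD : forall x y, ab (x + y) <= ab x + ab y;
  ab_nat : forall m : nat, ab m%:R = m%:R;
  ab_surj : forall r : R, 0 <= r -> exists z, ab z = r;
  ab_small : forall e : K, 0 < e ->
    exists2 d : R, 0 < d & forall z, ab z < d -> `|z| < e;
  ab_complete : forall u : nat -> K,
    cvgn (series (fun k => ab (u k.+1 - u k))) ->
    exists l, (fun k => ab (u k - l)) @ \oo --> (0 : R)
}.

(** * Inequalities for Euclidean sums *)

Lemma sum_sqr_eq0 (R : realFieldType) n (a : 'I_n -> R) :
  \sum_i a i ^+ 2 = 0 -> forall i, a i = 0.
Proof.
move=> a0 i; apply/eqP; rewrite -sqrf_eq0.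
by move/psumr_eq0P: a0 => -> // j _; exact: sqr_ge0.
Qed.

(** With [A] and [B] the two square roots, the nonnegative sum of the [(B * a i - A * b i) ^+ 2]
    equals [2 * (A * B)] times the difference of the two sides. If [A * B = 0], one family
    vanishes. *)
Lemma cauchy_schwarz (R : rcfType) n (a b : 'I_n -> R) :
  \sum_i a i * b i <= Num.sqrt (\sum_i a i ^+ 2) * Num.sqrt (\sum_i b i ^+ 2).
Proof.
set A := Num.sqrt _; set B := Num.sqrt _.
have A2 : A ^+ 2 = \sum_i a i ^+ 2 by rewrite sqr_sqrtr ?sumr_ge0// => i _; exact: sqr_ge0.
have B2 : B ^+ 2 = \sum_i b i ^+ 2 by rewrite sqr_sqrtr ?sumr_ge0// => i _; exact: sqr_ge0.
have A0 : 0 <= A by exact: sqrtr_ge0.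
have B0 : 0 <= B by exact: sqrtr_ge0.
have [/eqP AB|AB] := eqVneq (A * B) 0.
  rewrite (eqP AB) big1// => i _.
  move: AB; rewrite mulf_eq0 => /orP[] /eqP AB0.
    by move: A2; rewrite AB0 expr0n/= => /esym/sum_sqr_eq0 ->; rewrite mul0r.
  by move: B2; rewrite AB0 expr0n/= => /esym/sum_sqr_eq0 ->; rewrite mulr0.
have ABgt0 : 0 < A * B by rewrite lt_def AB mulr_ge0.
have : 0 <= \sum_i (B * a i - A * b i) ^+ 2 by rewrite sumr_ge0// => i _; exact: sqr_ge0.
have -> : \sum_i (B * a i - A * b i) ^+ 2 =
    B ^+ 2 * (\sum_i a i ^+ 2) + A ^+ 2 * (\sum_i b i ^+ 2)
    - 2 * (A * B) * (\sum_i a i * b i).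
  rewrite !mulr_sumr -sumrN -!big_split/=; apply: eq_bigr => i _; ring.
rewrite -A2 -B2 => H; rewrite -(ler_pM2l ABgt0); lra.
Qed.

Lemma minkowski (R : rcfType) n (a b : 'I_n -> R) :
  Num.sqrt (\sum_i (a i + b i) ^+ 2) <=
  Num.sqrt (\sum_i a i ^+ 2) + Num.sqrt (\sum_i b i ^+ 2).
Proof.
have CS := cauchy_schwarz a b; move: CS.
set A := Num.sqrt (\sum_i a i ^+ 2); set B := Num.sqrt (\sum_i b i ^+ 2) => CS.
have A2 : A ^+ 2 = \sum_i a i ^+ 2 by rewrite sqr_sqrtr ?sumr_ge0// => i _; exact: sqr_ge0.
have B2 : B ^+ 2 = \sum_i b i ^+ 2 by rewrite sqr_sqrtr ?sumr_ge0// => i _; exact: sqr_ge0.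
have AB0 : 0 <= A + B by rewrite addr_ge0 ?sqrtr_ge0.
rewrite -(ger0_norm AB0) -sqrtr_sqr ler_wsqrtr//.
have -> : \sum_i (a i + b i) ^+ 2 =
    \sum_i a i ^+ 2 + \sum_i b i ^+ 2 + 2 * \sum_i a i * b i.
  by rewrite mulr_sumr -!big_split/=; apply: eq_bigr => i _; ring.
rewrite -A2 -B2; lra.
Qed.

(** * The operator norm *)

Section opnorm.
Context (R : realType) (K : numFieldType) (ab : K -> R).
Hypothesis hab : complete_abs ab.
Local Notation vn := (vnorm2 ab).
Local Notation N := (opnorm2 ab).

Lemma ab0 : ab 0 = 0. Proof. exact: (ab_nat hab 0%N). Qed.

Lemma ab1 : ab 1 = 1. Proof. exact: (ab_nat hab 1%N). Qed.

Lemma abN x : ab (- x) = ab x.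
Proof.
rewrite -mulN1r (abM hab); suff -> : ab (-1) = 1 by rewrite mul1r.
have : ab (-1) ^+ 2 = 1 by rewrite expr2 -(abM hab) mulrNN mulr1 ab1.
by move=> /eqP; rewrite sqrp_eq1 ?(ab_ge0 hab)// => /eqP.
Qed.

Lemma ab_eq0 x : ab x = 0 -> x = 0.
Proof.
move=> x0; apply/eqP; apply: contraT => xN0.
by have := abM hab x x^-1; rewrite divff// ab1 x0 mul0r => /eqP; rewrite oner_eq0.
Qed.

Lemma ab_sum I (r : seq I) (P : pred I) (F : I -> K) :
  ab (\sum_(i <- r | P i) F i) <= \sum_(i <- r | P i) ab (F i).
Proof.
elim/big_ind2 : _ => [|x a y b xa yb|//]; first by rewrite ab0.
exact: le_trans (abD hab _ _) (lerD xa yb).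
Qed.

Lemma vnorm2_ge0 n (x : 'cV[K]_n) : 0 <= vn x. Proof. exact: sqrtr_ge0. Qed.

Lemma vnorm2D n (x y : 'cV[K]_n) : vn (x + y) <= vn x + vn y.
Proof.
apply: le_trans (minkowski (fun i => ab (x i ord0)) (fun i => ab (y i ord0))).
rewrite ler_wsqrtr// ler_sum// => i _.
by rewrite mxE lerXn2r ?nnegrE ?addr_ge0 ?(ab_ge0 hab)// (abD hab).
Qed.

Lemma vnorm2Z n c (x : 'cV[K]_n) : vn (c *: x) = ab c * vn x.
Proof.
rewrite /vnorm2 (eq_bigr (fun i => ab c ^+ 2 * ab (x i ord0) ^+ 2)).
  by rewrite -mulr_sumr sqrtrM ?sqr_ge0// sqrtr_sqr ger0_norm ?(ab_ge0 hab).
by move=> i _; rewrite mxE (abM hab) exprMn.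
Qed.

Lemma ab_le_vnorm2 n (x : 'cV[K]_n) i : ab (x i ord0) <= vn x.
Proof.
rewrite -[leLHS]ger0_norm ?(ab_ge0 hab)// -sqrtr_sqr ler_wsqrtr//.
by rewrite (bigD1 i)//= lerDl sumr_ge0// => j _; exact: sqr_ge0.
Qed.

Lemma vnorm20 n : vn (0 : 'cV[K]_n) = 0.
Proof. by rewrite -(scale0r 0) vnorm2Z ab0 mul0r. Qed.

Lemma vnorm2_eq0 n (x : 'cV[K]_n) : vn x = 0 -> x = 0.
Proof.
move=> x0; apply/matrixP => i j; rewrite ord1 mxE; apply: ab_eq0; apply/le_anti.
by rewrite -{1}x0 ab_le_vnorm2 (ab_ge0 hab).
Qed.

Lemma vnorm2_delta n (j : 'I_n) : vn (delta_mx j ord0) = 1.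
Proof.
rewrite /vnorm2 (bigD1 j)//= big1 ?addr0 => [|i /negbTE ij].
  by rewrite mxE !eqxx ab1 expr1n sqrtr1.
by rewrite mxE ij ab0 expr0n.
Qed.

Lemma vnorm2_le_sum n (x : 'cV[K]_n) : vn x <= \sum_i ab (x i ord0).
Proof.
have s0 : 0 <= \sum_i ab (x i ord0) by apply: sumr_ge0 => i _; exact: ab_ge0.
rewrite -[leRHS]ger0_norm// -sqrtr_sqr ler_wsqrtr// expr2 mulr_sumr ler_sum// => i _.
rewrite expr2 ler_wpM2r ?(ab_ge0 hab)// (bigD1 i)//= lerDl sumr_ge0// => j _.
exact: ab_ge0.
Qed.

(** A crude bound for the operator norm: it makes the supremum defining [opnorm2] finite and later
    turns entrywise convergence into convergence in norm. *)
Definition entry_sum n (A : 'M[K]_n) : R := \sum_i \sum_j ab (A i j).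

Lemma vnorm2_mul_le n (A : 'M[K]_n) x : vn x <= 1 -> vn (A *m x) <= entry_sum A.
Proof.
move=> x1; apply: le_trans (vnorm2_le_sum _) _; apply: ler_sum => i _.
rewrite mxE; apply: le_trans (ab_sum _ _ _) _; apply: ler_sum => j _.
by rewrite (abM hab) ler_piMr ?(ab_ge0 hab)// (le_trans (ab_le_vnorm2 _ _)).
Qed.

Lemma opnorm2_has_sup n (A : 'M[K]_n) :
  has_sup [set vn (A *m x) | x in [set x : 'cV[K]_n | vn x <= 1]].
Proof.
split; first by exists (vn (A *m 0)), 0 => //=; rewrite vnorm20.
by exists (entry_sum A) => _ [x x1 <-]; exact: vnorm2_mul_le.
Qed.

Lemma opnorm2_ub n (A : 'M[K]_n) c :
  (forall x, vn x <= 1 -> vn (A *m x) <= c) -> N A <= c.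
Proof.
move=> Ac; apply: ge_sup; first by case: (opnorm2_has_sup A).
by move=> _ [x x1 <-]; exact: Ac.
Qed.

Lemma opnorm2_le_entry_sum n (A : 'M[K]_n) : N A <= entry_sum A.
Proof. by apply: opnorm2_ub => x; exact: vnorm2_mul_le. Qed.

Lemma vnorm2_mul n (A : 'M[K]_n) x : vn (A *m x) <= N A * vn x.
Proof.
have N1 y : vn y <= 1 -> vn (A *m y) <= N A.
  move=> y1; apply: sup_upper_bound; first exact: opnorm2_has_sup.
  by exists y.
have [x0|x0] := eqVneq (vn x) 0.
  by rewrite (vnorm2_eq0 x0) mulmx0 vnorm20 mulr0.
have xgt0 : 0 < vn x by rewrite lt_def x0 vnorm2_ge0.
(* The norm of [x] lies in [R], so normalising [x] needs a scalar of [K] with that absolute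
   value. *)
have [c abc] := ab_surj hab (ltW xgt0).
have c0 : c != 0 by apply: contra_neq x0 => c0; rewrite -abc c0 ab0.
have -> : x = c *: (c^-1 *: x) by rewrite scalerA divff// scale1r.
rewrite -scalemxAr !vnorm2Z abc mulrCA ler_wpM2l ?vnorm2_ge0//.
have -> : ab c^-1 * vn x = 1 by rewrite -abc -(abM hab) mulVf// ab1.
rewrite mulr1 N1// vnorm2Z -abc -(abM hab) mulVf// ab1//.
Qed.

Lemma opnorm2_ge0 n (A : 'M[K]_n) : 0 <= N A.
Proof.
apply: sup_upper_bound; first exact: opnorm2_has_sup.
by exists 0; rewrite /= ?mulmx0 vnorm20.
Qed.

Lemma opnorm2D n (A B : 'M[K]_n) : N (A + B) <= N A + N B.
Proof.
apply: opnorm2_ub => x x1; rewrite mulmxDl (le_trans (vnorm2D _ _))//.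
by rewrite lerD// (le_trans (vnorm2_mul _ _))// ler_piMr ?opnorm2_ge0.
Qed.

Lemma opnorm2M n (A B : 'M[K]_n) : N (A *m B) <= N A * N B.
Proof.
apply: opnorm2_ub => x x1; rewrite -mulmxA (le_trans (vnorm2_mul _ _))//.
by rewrite ler_wpM2l ?opnorm2_ge0// (le_trans (vnorm2_mul _ _))// ler_piMr ?opnorm2_ge0.
Qed.

Lemma opnorm2Z n c (A : 'M[K]_n) : N (c *: A) <= ab c * N A.
Proof.
apply: opnorm2_ub => x x1; rewrite -scalemxAl vnorm2Z ler_wpM2l ?(ab_ge0 hab)//.
by rewrite (le_trans (vnorm2_mul _ _))// ler_piMr ?opnorm2_ge0.
Qed.

Lemma opnorm20 n : N (0 : 'M[K]_n) = 0.
Proof.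
apply/le_anti; rewrite opnorm2_ge0 andbT.
by apply: opnorm2_ub => x _; rewrite mul0mx vnorm20.
Qed.

(** Not an equality: in size 0 the identity has norm 0. *)
Lemma opnorm2_1 n : N (1%:M : 'M[K]_n) <= 1.
Proof. by apply: opnorm2_ub => x; rewrite mul1mx. Qed.

Lemma opnorm2N n (A : 'M[K]_n) : N (- A) = N A.
Proof.
have H (B : 'M[K]_n) : N (- B) <= N B.
  by rewrite -scaleN1r (le_trans (opnorm2Z _ _))// abN ab1 mul1r.
by apply/le_anti; rewrite H -{1}(opprK A) H.
Qed.

Lemma opnorm2B n (A B : 'M[K]_n) : N (A - B) <= N A + N B.
Proof. by rewrite -(opnorm2N B) opnorm2D. Qed.

Lemma opnorm2_distC n (A B : 'M[K]_n) : N (A - B) = N (B - A).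
Proof. by rewrite -opnorm2N opprB. Qed.

Lemma opnorm2_sum n I (r : seq I) (P : pred I) (F : I -> 'M[K]_n) :
  N (\sum_(i <- r | P i) F i) <= \sum_(i <- r | P i) N (F i).
Proof.
elim/big_ind2 : _ => [|x a y b xa yb|//]; first by rewrite opnorm20.
exact: le_trans (opnorm2D _ _) (lerD xa yb).
Qed.

Lemma opnorm2X n k (A : 'M[K]_n) : N (A ^+ k) <= N A ^+ k.
Proof.
elim: k => [|k IH]; first exact: opnorm2_1.
by rewrite !exprS (le_trans (opnorm2M _ _))// ler_wpM2l ?opnorm2_ge0.
Qed.

Lemma ab_le_opnorm2 n (A : 'M[K]_n) i j : ab (A i j) <= N A.
Proof.
have -> : A i j = (A *m (delta_mx j ord0 : 'cV[K]_n)) i ord0.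
  rewrite mxE (bigD1 j)//= big1 ?addr0 => [|k /negbTE kj].
    by rewrite mxE !eqxx mulr1.
  by rewrite mxE kj mulr0.
by rewrite (le_trans (ab_le_vnorm2 _ _))// (le_trans (vnorm2_mul _ _))// vnorm2_delta mulr1.
Qed.

Lemma opnorm2_eq0 n (A : 'M[K]_n) : N A = 0 -> A = 0.
Proof.
move=> A0; apply/matrixP => i j; rewrite mxE; apply: ab_eq0; apply/le_anti.
by rewrite -{1}A0 ab_le_opnorm2 (ab_ge0 hab).
Qed.

End opnorm.

(** * The matrix exponential *)

(** Stated over a general algebra so that it covers both matrices and [R^o], whose scalar series
    majorises the matrix series. *)
Definition expsum (K : fieldType) (L : lalgType K) (x : L) (k : nat) : L :=
  \sum_(i < k) (i`!%:R)^-1 *: x ^+ i.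

(** The same triangle of index pairs is traversed by antidiagonals on the left and by columns on the
    right. *)
Lemma triangle_sum (V : nmodType) (F : nat -> nat -> V) k :
  \sum_(m < k) \sum_(i < m.+1) F (m - i)%N i =
  \sum_(j < k) \sum_(i < k | (i + j < k)%N) F i j.
Proof.
transitivity (\sum_(m < k) \sum_(j < k | (j <= m)%N) F (m - j)%N j).
  by apply: eq_bigr => m _; rewrite (big_ord_widen k (fun j => F (m - j)%N j)).
rewrite (exchange_big_dep xpredT)//=; apply: eq_bigr => j _.
rewrite -(big_mkord (fun m => (j <= m)%N) (fun m => F (m - j)%N j)).
rewrite -(big_mkord (fun i => (i + j < k)%N) (fun i => F i j)).
rewrite (big_cat_nat (n := j))//=; last exact: ltnW.
rewrite big_nat_cond big_pred0 => [|m]; last first.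
  by apply/negbTE/negP => /andP[/andP[_ mj]]; rewrite leqNgt mj.
rewrite [LHS]add0r big_nat_cond (eq_bigl (fun m => (j <= m < k)%N)); last first.
  by move=> m; case: (j <= m)%N; rewrite ?andbF ?andbT.
rewrite -big_nat -{1}(add0n (j : nat)) big_addn.
rewrite (big_nat_widen _ _ k) ?leq_subr//.
by apply: eq_big => [i|i _]; rewrite /= ?ltn_subRL ?addnK// addnC.
Qed.

(** By the binomial theorem and [triangle_sum], [expsum (x + y) k] collects the products of total
    degree below [k]. The remaining corner has nonnegative coefficients, so taking norms bounds it
    by the corner of the scalar series. *)
Lemma expsumD (K : numFieldType) (L : algType K) (x y : L) k : x * y = y * x ->
  expsum x k * expsum y k = expsum (x + y) k +
  \sum_(j < k) \sum_(i < k | (k <= i + j)%N)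
     ((i`!%:R)^-1 *: x ^+ i) * ((j`!%:R)^-1 *: y ^+ j).
Proof.
move=> xy; pose F i j := ((i`!%:R)^-1 *: x ^+ i) * ((j`!%:R)^-1 *: y ^+ j).
have -> : expsum (x + y) k = \sum_(m < k) \sum_(i < m.+1) F (m - i)%N i.
  apply: eq_bigr => m _; rewrite exprDn_comm// scaler_sumr.
  apply: eq_bigr => i _; rewrite /F -scalerAl -scalerAr scalerA -(scaler_nat 'C(m, i)) scalerA.
  congr (_ *: _).
  have im : (i <= m)%N by rewrite -ltnS.
  rewrite -(bin_fact im) !natrM.
  have f0 p : p`!%:R != 0 :> K by rewrite pnatr_eq0 -lt0n fact_gt0.
  have b0 : 'C(m, i)%:R != 0 :> K by rewrite pnatr_eq0 -lt0n bin_gt0.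
  by field; rewrite !f0 b0.
rewrite triangle_sum -big_split/= /expsum mulr_suml.
rewrite [LHS](eq_bigr (fun i : 'I_k => \sum_(j < k) F i j)); last first.
  by move=> i _; rewrite mulr_sumr.
rewrite exchange_big/=; apply: eq_bigr => j _.
by rewrite [LHS](bigID (fun i : 'I_k => (i + j < k)%N))/=; congr (_ + _);
  apply: eq_bigl => i; rewrite -leqNgt.
Qed.

(** * Convergence and completeness in operator norm *)

Section convergence.
Context (R : realType) (K : numFieldType) (ab : K -> R).
Hypothesis hab : complete_abs ab.
Local Notation N := (opnorm2 ab).

(** Norm convergence phrased as a limit in [R], so that no topology on matrices is involved. *)
Definition mcvg n (u : nat -> 'M[K]_n) (l : 'M[K]_n) :=
  (fun k => N (u k - l)) @ \oo --> (0 : R).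

Lemma squeeze0 (f g : nat -> R) :
  (forall k, 0 <= f k <= g k) -> g @ \oo --> (0 : R) -> f @ \oo --> (0 : R).
Proof.
move=> fg g0; apply: (squeeze_cvgr (f := fun=> 0) (h := g)) => //; first exact: nearW.
exact: cvg_cst.
Qed.

Lemma mcvg_le n (u : nat -> 'M[K]_n) l c :
  mcvg u l -> (forall k, N (u k) <= c) -> N l <= c.
Proof.
move=> ul uc; rewrite -subr_le0; apply: (cvgr_to_ge ul); apply: nearW => k.
rewrite lerBlDr; apply: le_trans (_ : N (u k - l) + N (u k) <= _); last by rewrite lerD2l.
by rewrite -{1}(subKr (u k) l) [leRHS]addrC (opnorm2B hab).
Qed.

Lemma mcvgB n (u v : nat -> 'M[K]_n) l m :
  mcvg u l -> mcvg v m -> mcvg (fun k => u k - v k) (l - m).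
Proof.
move=> ul vm; apply: (squeeze0 _ (g := fun k => N (u k - l) + N (v k - m))).
  by move=> k; rewrite (opnorm2_ge0 hab) opprD addrACA -opprD (opnorm2B hab).
by rewrite -(addr0 0); exact: cvgD.
Qed.

Lemma mcvg_cst n (l : 'M[K]_n) : mcvg (fun=> l) l.
Proof.
by rewrite /mcvg subrr (opnorm20 hab); exact: cvg_cst.
Qed.

Lemma mcvgM n (u v : nat -> 'M[K]_n) l m :
  mcvg u l -> mcvg v m -> mcvg (fun k => u k *m v k) (l *m m).
Proof.
move=> ul vm.
apply: (squeeze0 _ (g := fun k =>
  N (u k - l) * N (v k - m) + N l * N (v k - m) + N (u k - l) * N m)).
  move=> k; rewrite (opnorm2_ge0 hab)/=.
  have -> : u k *m v k - l *m m =
      (u k - l) *m (v k - m) + l *m (v k - m) + (u k - l) *m m.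
    by rewrite -mulmxDl subrK mulmxBr mulmxBl addrA subrK.
  apply: le_trans (opnorm2D hab _ _) _; rewrite lerD ?(opnorm2M hab)//.
  by apply: le_trans (opnorm2D hab _ _) _; rewrite lerD ?(opnorm2M hab).
have -> : (0 : R) = 0 * 0 + N l * 0 + 0 * N m by rewrite !mul0r mulr0 !addr0.
by apply: cvgD; [apply: cvgD|]; apply: cvgM => //; exact: cvg_cst.
Qed.

Lemma mcvg_unique n (u : nat -> 'M[K]_n) l m : mcvg u l -> mcvg u m -> l = m.
Proof.
move=> ul um; apply/eqP; rewrite -subr_eq0; apply/eqP; apply: (opnorm2_eq0 hab).
apply/le_anti; rewrite (opnorm2_ge0 hab) andbT.
apply: mcvg_le (mcvgB ul um) _ => k; by rewrite subrr (opnorm20 hab).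
Qed.

(** Links norm convergence to the entrywise limits in [K] that define [mexp]: entries are bounded by
    the norm, and [ab_small] passes from [ab] to the topology of [K]. *)
Lemma mcvg_lim n (u : nat -> 'M[K]_n) l i j :
  mcvg u l -> lim ((fun k => u k i j) @ \oo) = l i j.
Proof.
move=> ul; apply/cvg_lim; first exact: norm_hausdorff.
apply/cvgrPdist_lt => e /(ab_small hab)[d d0 de].
move/cvgrPdist_lt : ul => /(_ d d0); apply: filterS => k.
rewrite sub0r normrN ger0_norm ?(opnorm2_ge0 hab)// => ukd.
apply: de; rewrite -(abN hab) opprB (le_lt_trans _ ukd)//.
by have := ab_le_opnorm2 hab (u k - l) i j; rewrite !mxE.
Qed.

(** The increments of each entry are dominated by those in norm, so [ab_complete] gives entrywise
    limits; [entry_sum] controls the norm distance to the matrix they form. *)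
Lemma mcvg_complete n (u : nat -> 'M[K]_n) :
  cvgn (series (fun k => N (u k.+1 - u k))) -> exists l, mcvg u l.
Proof.
move=> cu.
have H i j : exists l, (fun k => ab (u k i j - l)) @ \oo --> (0 : R).
  apply: (ab_complete hab); apply: series_le_cvg cu => k.
  - exact: (ab_ge0 hab).
  - exact: (opnorm2_ge0 hab).
  - by have := ab_le_opnorm2 hab (u k.+1 - u k) i j; rewrite !mxE.
pose l := \matrix_(i, j) projT1 (cid (H i j)).
exists l; apply: (squeeze0 _ (g := fun k => entry_sum ab (u k - l))).
  by move=> k; rewrite (opnorm2_ge0 hab) (opnorm2_le_entry_sum hab).
have -> : (0 : R) = \sum_(i < n) \sum_(j < n) 0 by rewrite !big1.
do 2 (apply: cvg_big => [|? _]; first exact: add_continuous).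
by rewrite /l; under eq_fun do rewrite !mxE; case: cid.
Qed.

End convergence.

Lemma sum_inv_fact_le2 (R : realFieldType) m : \sum_(j < m) (j.+1`!%:R : R)^-1 <= 2.
Proof.
have pow_fact j : (2 ^ j <= j.+1`!)%N.
  by elim: j => // j IH; rewrite expnS factS leq_mul.
have sum_half k : \sum_(j < k) (2 ^+ j : R)^-1 = 2 - 2 * (2 ^+ k)^-1.
  elim: k => [|k IH]; first by rewrite big_ord0 expr0 invr1 mulr1 subrr.
  have p0 : 2 ^+ k != 0 :> R by rewrite expf_neq0// pnatr_eq0.
  by rewrite big_ord_recr/= IH exprS invfM; field.
apply: le_trans (_ : \sum_(j < m) (2 ^+ j : R)^-1 <= _); last first.
  by rewrite sum_half lerBlDr lerDl mulr_ge0// invr_ge0 exprn_ge0.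
apply: ler_sum => j _; rewrite lef_pV2 ?posrE ?exprn_gt0 ?ltr0n ?fact_gt0//.
by rewrite -natrX ler_nat.
Qed.

Section matrix_exponential.
Context (R : realType) (K : numFieldType) (ab : K -> R) (n : nat).
Hypothesis hab : complete_abs ab.
Local Notation N := (@opnorm2 R K ab n.+1).
Implicit Types X Y : 'M[K]_n.+1.

Lemma ab_inv_fact k : ab (k`!%:R)^-1 = (k`!%:R)^-1.
Proof.
have f0 (F : numFieldType) : k`!%:R != 0 :> F by rewrite pnatr_eq0 -lt0n fact_gt0.
apply: (mulfI (f0 R)); rewrite mulfV ?f0// -{1}(ab_nat hab k`!) -(abM hab).
by rewrite mulfV ?f0// (ab1 hab).
Qed.

Lemma opnorm2_expterm X k : N ((k`!%:R)^-1 *: X ^+ k) <= exp_coeff (N X) k.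
Proof.
rewrite (le_trans (opnorm2Z hab _ _))// /exp_coeff/= mulrC.
by rewrite ab_inv_fact ler_wpM2r ?invr_ge0// (opnorm2X hab).
Qed.

Lemma mexp_cvg X : mcvg ab (expsum X) (mexp X).
Proof.
have [l Xl] : exists l, mcvg ab (expsum X) l.
  apply: (mcvg_complete hab); apply: series_le_cvg (is_cvg_series_exp_coeff (N X)) => k.
  - exact: (opnorm2_ge0 hab).
  - exact/exp_coeff_ge0/(opnorm2_ge0 hab).
  - by rewrite /expsum big_ord_recr/= addrAC subrr add0r opnorm2_expterm.
suff -> : mexp X = l by [].
by apply/matrixP => i j; rewrite mxE; exact: (mcvg_lim hab).
Qed.

(** The corner left by [expsumD] is bounded in norm by the corner for the real numbers [N X] and
    [N Y], which tends to 0 because the real exponential is multiplicative. *)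
Lemma mexpD X Y : X * Y = Y * X -> mexp X * mexp Y = mexp (X + Y).
Proof.
move=> XY.
have cvg0 := mcvgB hab (mcvgM hab (mexp_cvg X) (mexp_cvg Y)) (mexp_cvg (X + Y)).
apply/eqP; rewrite -subr_eq0; apply/eqP; apply: (mcvg_unique hab cvg0).
rewrite /mcvg; under eq_fun do rewrite subr0.
pose e (x : R) k := series (exp_coeff x) k.
have eE x k : e x k = expsum (x : R^o) k.
  rewrite /e seriesEord; apply: eq_bigr => i _.
  by rewrite /exp_coeff/= mulrC.
apply: (squeeze0 (g := fun k => e (N X) k * e (N Y) k - e (N X + N Y) k)).
  move=> k; rewrite (opnorm2_ge0 hab)/= -[_ *m _]/(expsum X k * expsum Y k).
  rewrite (expsumD _ XY) addrAC subrr add0r !eE (expsumD _ (mulrC _ _)) addrAC subrr add0r.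
  rewrite (le_trans (opnorm2_sum hab _ _ _))//; apply: ler_sum => j _.
  rewrite (le_trans (opnorm2_sum hab _ _ _))//; apply: ler_sum => i _.
  rewrite (le_trans (opnorm2M hab _ _))//.
  rewrite ler_pM ?(opnorm2_ge0 hab)// (le_trans (opnorm2_expterm _ _))//.
    by rewrite /exp_coeff/= mulrC.
  by rewrite /exp_coeff/= mulrC.
have ec x : e x @ \oo --> expR x by exact: is_cvg_series_exp_coeff.
rewrite -(subrr (expR (N X + N Y))) {1}expRD.
by apply: cvgB; [apply: cvgM|]; exact: ec.
Qed.

(** A mean value bound for powers that needs no commutation: one factor is changed at a time. *)
Lemma opnorm2_exprB r X Y k : N X <= r -> N Y <= r ->
  N (X ^+ k.+1 - Y ^+ k.+1) <= k.+1%:R * r ^+ k * N (X - Y).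
Proof.
move=> Xr Yr; have r0 : 0 <= r by apply: le_trans Xr; exact: (opnorm2_ge0 hab).
elim: k => [|k IH]; first by rewrite !expr1 expr0 !mul1r.
have -> : X ^+ k.+2 - Y ^+ k.+2 =
    X * (X ^+ k.+1 - Y ^+ k.+1) + (X - Y) * Y ^+ k.+1.
  by rewrite !exprS mulrBr mulrBl addrA subrK.
rewrite (le_trans (opnorm2D hab _ _))//.
have -> : k.+2%:R * r ^+ k.+1 * N (X - Y) =
    r * (k.+1%:R * r ^+ k * N (X - Y)) + N (X - Y) * r ^+ k.+1.
  by rewrite -[k.+2%:R]natr1 exprS; ring.
rewrite lerD// (le_trans (opnorm2M hab _ _))//.
  by rewrite ler_pM ?(opnorm2_ge0 hab).
rewrite ler_wpM2l ?(opnorm2_ge0 hab)// (le_trans (opnorm2X hab _ _))//.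
by rewrite lerXn2r ?nnegrE ?(opnorm2_ge0 hab).
Qed.

Lemma mexp_sub_id_lipschitz r X Y : r <= 1 -> N X <= r -> N Y <= r ->
  N ((mexp X - X) - (mexp Y - Y)) <= 2 * r * N (X - Y).
Proof.
move=> r1 Xr Yr; have r0 : 0 <= r by apply: le_trans Xr; exact: (opnorm2_ge0 hab).
(* Shifting by 2 ensures that every partial sum contains the terms of degree 0 and 1. *)
have shift (Z : 'M[K]_n.+1) : mcvg ab (fun k => expsum Z k.+2) (mexp Z).
  have := mexp_cvg Z; rewrite /mcvg -(cvg_shiftn 2).
  by under eq_fun do rewrite /= addn2.
have c (Z : 'M[K]_n.+1) := mcvgB hab (shift Z) (mcvg_cst hab Z).
apply: (mcvg_le hab (mcvgB hab (c X) (c Y))) => k.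
have E2 (Z : 'M[K]_n.+1) : expsum Z k.+2 - Z = 1 + \sum_(j < k) (j.+2`!%:R)^-1 *: Z ^+ j.+2.
  rewrite /expsum !big_ord_recl/= !fact0 !invr1 !scale1r expr1.
  by rewrite addrCA addrAC subrr add0r.
rewrite !E2 opprD addrACA subrr add0r -sumrB.
rewrite (le_trans (opnorm2_sum hab _ _ _))//.
apply: le_trans (_ : \sum_(j < k) (j.+1`!%:R)^-1 * (r * N (X - Y)) <= _); last first.
  rewrite -mulr_suml -mulrA ler_wpM2r ?mulr_ge0 ?(opnorm2_ge0 hab)//.
  exact: sum_inv_fact_le2.
apply: ler_sum => j _; rewrite -scalerBr (le_trans (opnorm2Z hab _ _))//.
have fE : (j.+1`!%:R : R)^-1 = (j.+2`!%:R)^-1 * j.+2%:R.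
  rewrite [j.+2`!]factS natrM invfM mulrAC mulVf ?mul1r//.
  by rewrite pnatr_eq0.
rewrite ab_inv_fact fE -mulrA ler_wpM2l ?invr_ge0//.
rewrite (le_trans (opnorm2_exprB _ Xr Yr))// -mulrA ler_wpM2l//.
by rewrite ler_wpM2r ?(opnorm2_ge0 hab)// exprS ler_piMr// exprn_ile1.
Qed.

End matrix_exponential.

(** * Logarithms near the identity *)

Section near_identity.
Context (R : realType) (K : numFieldType) (ab : K -> R) (n : nat).
Hypothesis hab : complete_abs ab.
Local Notation N := (@opnorm2 R K ab n.+1).
Implicit Types X Y : 'M[K]_n.+1.

Lemma mexp0 : mexp (0 : 'M[K]_n.+1) = 1.
Proof.
have := mexp_cvg hab (0 : 'M[K]_n.+1); rewrite /mcvg -cvg_shiftS => c.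
apply: (mcvg_unique hab c); rewrite /mcvg.
suff E k : expsum (0 : 'M[K]_n.+1) k.+1 = 1.
  by under eq_fun do rewrite E; exact: (mcvg_cst hab).
rewrite /expsum big_ord_recl/= fact0 invr1 scale1r expr0 big1 ?addr0// => i _.
by rewrite expr0n scaler0.
Qed.

Lemma mexp_linear X : N X <= 1 -> N (mexp X - 1 - X) <= 2 * N X ^+ 2.
Proof.
move=> X1; have := mexp_sub_id_lipschitz hab X1 (lexx _) (Y := 0).
by rewrite (opnorm20 hab) mexp0 !subr0 addrAC expr2 mulrA; apply; exact: (opnorm2_ge0 hab).
Qed.

(* [Z] is the fixed point of [X |-> 1 + E - (mexp X - X)], a contraction of
   ratio 1/2 on the ball of radius [2 * N E]. *)
Lemma mexp_onto (E : 'M[K]_n.+1) : N E <= 8^-1 ->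
  exists2 Z, mexp Z = 1 + E & N Z <= N E + 8 * N E ^+ 2.
Proof.
move=> E8; pose f X := 1 + E - (mexp X - X).
have E0 := opnorm2_ge0 hab E.
pose r := 2 * N E.
(* The Lipschitz constant is [2 * r = 4 * N E], at most 1/2 because [N E <= 8^-1]. *)
have fL X Y : N X <= r -> N Y <= r -> N (f X - f Y) <= 2^-1 * N (X - Y).
  move=> Xr Yr; have subKK (a U V : 'M[K]_n.+1) : a - U - (a - V) = V - U.
    by rewrite opprB addrC addrA subrK.
  rewrite subKK (opnorm2_distC hab).
  rewrite (le_trans (mexp_sub_id_lipschitz hab _ Xr Yr))//.
    by rewrite /r; lra.
  by rewrite ler_wpM2r ?(opnorm2_ge0 hab)// /r; lra.
have f0 : f 0 = E by rewrite /f mexp0 subr0 (addrC 1) addrK.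
have N0r : N 0 <= r by rewrite (opnorm20 hab) /r; lra.
(* Since [f 0 = E], the image has norm at most [N E + r / 2 = r]; hence the radius [2 * N E]. *)
have fr X : N X <= r -> N (f X) <= r.
  move=> Xr; have := fL X 0 Xr N0r; rewrite f0 subr0 => fXE.
  have := opnorm2D hab (f X - E) E; rewrite subrK; move: Xr fXE; rewrite /r; lra.
pose u k := iter k f 0.
have ur k : N (u k) <= r by elim: k => //= k; exact: fr.
have us k : N (u k.+1 - u k) <= geometric (N E) 2^-1 k.
  elim: k => [|k IH]; first by rewrite /= f0 subr0 expr0 mulr1.
  rewrite (le_trans (fL _ _ (ur k.+1) (ur k)))//= exprS mulrCA ler_wpM2l ?invr_ge0//.
have [Z uZ] : exists Z, mcvg ab u Z.
  apply: (mcvg_complete hab).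
  apply: series_le_cvg (@is_cvg_geometric_series R (N E) 2^-1 _) => [k|k|k|].
  - exact: (opnorm2_ge0 hab).
  - by rewrite /= mulr_ge0// exprn_ge0// invr_ge0.
  - exact: us.
  - by rewrite ger0_norm ?invr_ge0// invf_lt1// ltr1n.
have Zr : N Z <= r by exact: (mcvg_le hab uZ ur).
have fZ : f Z = Z.
  apply: (mcvg_unique hab (u := fun k => u k.+1)).
    apply: (squeeze0 (g := fun k => 2^-1 * N (u k - Z))).
      by move=> k; rewrite (opnorm2_ge0 hab)/= fL.
    by rewrite -(mulr0 2^-1); apply: cvgM => //; exact: cvg_cst.
  by move: uZ; rewrite /mcvg -cvg_shiftS.
have eZ : mexp Z = 1 + E.
  by move/eqP: fZ; rewrite subr_eq [Z + _]addrC subrK => /eqP.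
(* Comparing [Z] with 0 gives [N (E - Z) <= 2 * r * N Z <= 2 * r ^+ 2 = 8 * N E ^+ 2]. *)
exists Z => //; have := mexp_sub_id_lipschitz hab (_ : r <= 1) Zr N0r.
rewrite mexp0 !subr0 eZ addrAC (addrC 1 E) addrK => /(_ _) ZE.
have := opnorm2B hab E (E - Z); rewrite subKr.
have {}ZE : N (E - Z) <= 2 * r * N Z by apply: ZE; rewrite /r; lra.
have : 2 * r * N Z <= 2 * r * r by rewrite ler_wpM2l// /r; lra.
rewrite /r in ZE *; lra.
Qed.

End near_identity.

(** * The strict bound on the Magnus exponent *)

Section magnus_strict.
Context (R : realType) (K : numFieldType) (ab : K -> R) (n : nat).
Hypothesis hab : complete_abs ab.
Local Notation N := (@opnorm2 R K ab n.+1).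
Implicit Types X Y : 'M[K]_n.+1.

(** Put [s = N X + N Y] and [E = mexp X * mexp Y - 1]. Then [N E <= 10 * s <= 8^-1], so [mexp_onto]
    applies; [E] is within [9 * s ^+ 2] of [X + Y], and [8 * N E ^+ 2] adds at most [800 * s ^+ 2],
    whence 809. *)
Lemma mexpM_small X Y : N X + N Y <= 80^-1 ->
  exists2 Z, mexp Z = mexp X * mexp Y &
             N Z <= N (X + Y) + 809 * (N X + N Y) ^+ 2.
Proof.
move=> XY; have X0 := opnorm2_ge0 hab X; have Y0 := opnorm2_ge0 hab Y.
have X1 : N X <= 1 by lra. have Y1 : N Y <= 1 by lra.
have PX := mexp_linear hab X1; have PY := mexp_linear hab Y1.
have XYD := opnorm2D hab X Y.
have rem (U : 'M[K]_n.+1) : N U <= 1 -> N (mexp U - 1) <= 3 * N U.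
  move=> U1; have PU := mexp_linear hab U1.
  have := opnorm2D hab (mexp U - 1 - U) U; rewrite subrK.
  have : N U ^+ 2 <= N U by rewrite expr2 ler_piMr ?(opnorm2_ge0 hab).
  lra.
have prodXY : N ((mexp X - 1) * (mexp Y - 1)) <= 9 * (N X * N Y).
  rewrite (le_trans (opnorm2M hab _ _))//.
  have -> : 9 * (N X * N Y) = (3 * N X) * (3 * N Y) by ring.
  by rewrite ler_pM ?(opnorm2_ge0 hab)// rem.
pose E := mexp X * mexp Y - 1.
(* Isolates the linear part; the other three terms are quadratic by [PX], [PY] and [prodXY]. *)
have EE : E = (X + Y) + ((mexp X - 1 - X) + (mexp Y - 1 - Y) + (mexp X - 1) * (mexp Y - 1)).
  rewrite addrA addrACA ![_ + (_ - 1 - _)]addrC !subrK mulrBl mul1r.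
  rewrite [X in _ = _ + X]addrC addrA addrK mulrBr mulr1.
  by rewrite [RHS]addrC addrA subrK.
have EXY : N E <= N (X + Y) + 9 * (N X + N Y) ^+ 2.
  have X2 := sqr_ge0 (N X); have Y2 := sqr_ge0 (N Y).
  have XYge0 := mulr_ge0 X0 Y0.
  rewrite EE (le_trans (opnorm2D hab _ _))// lerD2l.
  have H1 := opnorm2D hab (mexp X - 1 - X + (mexp Y - 1 - Y)) ((mexp X - 1) * (mexp Y - 1)).
  have H2 := opnorm2D hab (mexp X - 1 - X) (mexp Y - 1 - Y).
  lra.
have s0 : 0 <= N X + N Y by rewrite addr_ge0.
have s2 : (N X + N Y) ^+ 2 <= 80^-1 * (N X + N Y) by rewrite expr2 ler_wpM2r.
have E10 : N E <= 10 * (N X + N Y) by lra.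
have E2 : N E ^+ 2 <= 100 * (N X + N Y) ^+ 2.
  have -> : 100 * (N X + N Y) ^+ 2 = (10 * (N X + N Y)) ^+ 2 by ring.
  by rewrite lerXn2r ?nnegrE ?(opnorm2_ge0 hab)// mulr_ge0.
have [|Z eZ NZ] := mexp_onto hab (E := E); first by lra.
exists Z; first by rewrite eZ addrC subrK.
lra.
Qed.

Lemma magnus_le3 X Y Z :
  magnus ab (mexp X *m mexp Y *m mexp Z) <= N X + N Y + N Z.
Proof.
apply: ge_inf.
  exists 0 => _ [m [Bs [_ ->]]]; apply: sumr_ge0 => i _; exact: (opnorm2_ge0 hab).
(* [magnus] multiplies with the last index leftmost, so the list is reversed; the witness 2 stands
   for three factors. *)
exists 2, (fun i : 'I_3 => nth 0 [:: Z; Y; X] i); split.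
  by rewrite !big_ord_recl big_ord0/= mulmx1 mulmxA.
rewrite !big_ord_recl big_ord0/=; ring.
Qed.

(** Used to evaluate [ab] at the copies in [K] of both [t] and [1 - t]. *)
Lemma ab_ratio (p q : nat) : (0 < q)%N -> ab (p%:R / q%:R) = p%:R / q%:R.
Proof.
move=> q0; have q0' (F : numFieldType) : q%:R != 0 :> F by rewrite pnatr_eq0 -lt0n.
apply: (mulIf (q0' R)); rewrite divfK ?q0'//.
by rewrite -[in LHS](ab_nat hab q) -(abM hab) divfK ?q0'// (ab_nat hab).
Qed.

(* The step is [t = k.+1%:R^-1] so that it also makes sense in [K]. *)
Lemma magnus_mexpM_lt (A B : 'M[K]_n.+1) :
  N (A + B) < N A + N B -> magnus ab (mexp A *m mexp B) < N A + N B.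
Proof.
move=> AB; set x := N A + N B in AB *; set c := N (A + B) in AB.
have A0 : 0 <= N A := opnorm2_ge0 hab A; have B0 : 0 <= N B := opnorm2_ge0 hab B.
have c0 : 0 <= c := opnorm2_ge0 hab (A + B).
have x0 : 0 < x by lra.
have d0 : 0 < x - c by rewrite subr_gt0.
(* From [t * M < 1], the first summand puts the scaled matrices in the range of [mexpM_small], and
   the second makes the quadratic error smaller than the gain [t * (x - c)]. *)
pose M := 80 * x + 809 * x ^+ 2 / (x - c).
have M0 : 0 <= M by rewrite addr_ge0// ?divr_ge0 ?mulr_ge0 ?sqr_ge0// ltW.
pose k := Num.truncn M; have Mk : M < k.+1%:R by exact: truncnS_gt.
pose t : R := k.+1%:R^-1.
have t0 : 0 < t by rewrite invr_gt0.
have tk : t * k.+1%:R = 1 by rewrite mulVf// pnatr_eq0.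
have tM : t * M < 1 by rewrite -tk ltr_pM2l.
have q0 : 0 <= 809 * x ^+ 2 / (x - c) by rewrite ?divr_ge0 ?mulr_ge0 ?sqr_ge0// ltW.
have tx : t * x <= 80^-1.
  suff : t * (80 * x) < 1 by lra.
  apply: le_lt_trans tM; rewrite ler_pM2l// /M; lra.
have txx : 809 * (t * x) ^+ 2 < t * (x - c).
  have : t * (809 * x ^+ 2 / (x - c)) < 1.
    by apply: le_lt_trans tM; rewrite ler_pM2l// /M lerDr mulr_ge0// ltW.
  rewrite mulrA ltr_pdivrMr// mul1r => h.
  have -> : 809 * (t * x) ^+ 2 = t * (t * (809 * x ^+ 2)) by ring.
  by rewrite ltr_pM2l.
pose tau : K := 1%:R / k.+1%:R.
have Ntau (U : 'M[K]_n.+1) : N (tau *: U) <= t * N U.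
  by rewrite (le_trans (opnorm2Z hab _ _))// ab_ratio// div1r.
(* The triangle inequality would only give the factor [1 + t]; writing the scalar as a ratio of
   naturals gives [1 - t]. *)
have Ncotau (U : 'M[K]_n.+1) : N (U - tau *: U) <= (1 - t) * N U.
  have -> : U - tau *: U = (k%:R / k.+1%:R) *: U.
    rewrite -{1}(scale1r U) -scalerBl; congr (_ *: _).
    have k0 : k.+1%:R != 0 :> K by rewrite pnatr_eq0.
    by rewrite /tau -{1}(divff k0) -mulrBl -natrB// subn1.
  rewrite (le_trans (opnorm2Z hab _ _))// ab_ratio// -/t.
  suff -> : k%:R * t = 1 - t by [].
  by move: tk; rewrite -natr1; lra.
have [|Z eZ NZ] := mexpM_small (X := tau *: A) (Y := tau *: B).
  by rewrite (le_trans _ tx)// /x mulrDr lerD ?Ntau.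
have s2 : (N (tau *: A) + N (tau *: B)) ^+ 2 <= (t * x) ^+ 2.
  rewrite lerXn2r ?nnegrE ?addr_ge0 ?(opnorm2_ge0 hab)//.
    by rewrite mulr_ge0// ltW.
  by rewrite /x mulrDr lerD ?Ntau.
have NAB : N (tau *: A + tau *: B) <= t * c by rewrite -scalerDr Ntau.
have commA : (A - tau *: A) * (tau *: A) = (tau *: A) * (A - tau *: A).
  by rewrite mulrBl mulrBr -(scalerAr tau A A) (scalerAl tau A A).
have commB : (tau *: B) * (B - tau *: B) = (B - tau *: B) * (tau *: B).
  by rewrite mulrBl mulrBr -(scalerAr tau B B) (scalerAl tau B B).
have -> : mexp A *m mexp B = mexp (A - tau *: A) *m mexp Z *m mexp (B - tau *: B).
  rewrite -[in LHS](subrK (tau *: A) A) -(mexpD hab commA).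
  rewrite -[in LHS](subrKC (tau *: B) B) -(mexpD hab commB) eZ.
  by rewrite -!mulmxE !mulmxA.
(* The three norms sum to at most [(1 - t) * x + t * c + 809 * (t * x) ^+ 2], which is below [x] by
   [txx]. *)
apply: le_lt_trans (magnus_le3 _ _ _) _.
have := Ncotau A; have := Ncotau B; rewrite /x in txx s2 *; lra.
Qed.

End magnus_strict.

(** * The real and complex absolute values *)

Lemma cvgn_of_dist (R : realType) (u : nat -> R) :
  cvgn (series (fun k => `|u k.+1 - u k|)) ->
  exists l, (fun k => `|u k - l|) @ \oo --> (0 : R).
Proof.
move=> cu; have {}cu : cvgn (series (telescope u)) by exact: (@normed_cvg R R^o).
have su k : u k = u 0%N + series (telescope u) k by rewrite -eq_sum_telescope.
exists (u 0%N + limn (series (telescope u))).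
rewrite -(@normr0 _ R) -(subrr (u 0%N + limn (series (telescope u)))).
apply: cvg_norm; apply: cvgB; last exact: cvg_cst.
rewrite [X in X @ _](funext su); apply: cvgD => //; exact: cvg_cst.
Qed.

Lemma complete_abs_real (R : realType) : complete_abs (@abR R).
Proof.
split; rewrite /abR.
- exact: normr_ge0.
- exact: normrM.
- exact: ler_normD.
- exact: normr_nat.
- by move=> r r0; exists r; rewrite ger0_norm.
- by move=> e e0; exists e.
- exact: cvgn_of_dist.
Qed.

(** Completeness reduces to the real case: the modulus dominates the real and imaginary parts and is
    at most the sum of their absolute values. *)
Lemma complete_abs_complex (R : realType) : complete_abs (@abC R).
Proof.
have normE (z : R[i]) : `|z| = (abC z)%:C%C by rewrite normc_def; case: z.
have abC_real (a : R) : abC (a%:C)%C = `|a|.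
  by rewrite /abC/= expr0n addr0 sqrtr_sqr.
have abC_imag (a : R) : abC (0 +i* a)%C = `|a|.
  by rewrite /abC/= expr0n add0r sqrtr_sqr.
have abC_Re (z : R[i]) : `|complex.Re z| <= abC z.
  by rewrite -lecR -normE normc_ge_Re.
have abC_Im (z : R[i]) : `|complex.Im z| <= abC z.
  by case: z => a b; rewrite /abC/= -sqrtr_sqr ler_wsqrtr// lerDr sqr_ge0.
have abC_le (z : R[i]) : abC z <= `|complex.Re z| + `|complex.Im z|.
  case: z => a b; rewrite [leRHS]/= -abC_real -abC_imag.
  have -> : (a +i* b)%C = (a%:C)%C + (0 +i* b)%C.
    by apply/eqP; rewrite eq_complex/= addr0 add0r !eqxx.
  exact: le_normcD.
split.
- by case=> a b; exact: sqrtr_ge0.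
- exact: ComplexField.Normc.normcM.
- exact: le_normcD.
- by move=> m; rewrite -(rmorph_nat (real_complex R)) abC_real normr_nat.
- by move=> r r0; exists (r%:C)%C; rewrite abC_real ger0_norm.
(* A positive element of [R[i]] is real, so its real part serves as the radius. *)
- case=> a b; rewrite ltcE/= => /andP[/eqP b0 a0]; exists a => // z za.
  by rewrite normE ltcE/= b0 eqxx.
- move=> u cu.
  have [lr ulr] : exists l, (fun k => `|complex.Re (u k) - l|) @ \oo --> (0 : R).
    apply: cvgn_of_dist; apply: series_le_cvg cu => k //.
      exact: le_trans (normr_ge0 _) (abC_Re _).
    by rewrite -raddfB; exact: abC_Re.
  have [li uli] : exists l, (fun k => `|complex.Im (u k) - l|) @ \oo --> (0 : R).
    apply: cvgn_of_dist; apply: series_le_cvg cu => k //.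
      exact: le_trans (normr_ge0 _) (abC_Re _).
    by rewrite -raddfB; exact: abC_Im.
  exists (lr +i* li)%C.
  apply: (squeeze0 (g := fun k => `|complex.Re (u k) - lr| + `|complex.Im (u k) - li|)).
    move=> k; rewrite (le_trans _ (abC_Re _))//=.
    by have := abC_le (u k - (lr +i* li)%C); rewrite !raddfB.
  by rewrite -(addr0 0); exact: cvgD.
Qed.

Theorem theorem5p2 (R : realType) (n : nat) :
  (forall A B : 'M[R]_n,
     opnorm2 (@abR R) (A + B) < opnorm2 (@abR R) A + opnorm2 (@abR R) B ->
     magnus (@abR R) (mexp A *m mexp B) < opnorm2 (@abR R) A + opnorm2 (@abR R) B)
  /\
  (forall A B : 'M[R[i]]_n,
     opnorm2 (@abC R) (A + B) < opnorm2 (@abC R) A + opnorm2 (@abC R) B ->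
     magnus (@abC R) (mexp A *m mexp B) < opnorm2 (@abC R) A + opnorm2 (@abC R) B).
Proof.
(* The analysis was done in size [n.+1]. In size 0 all norms vanish and the hypothesis reads
   [0 < 0]. *)
case: n => [|n]; last first.
  split=> A B; first exact: (magnus_mexpM_lt (complete_abs_real R)).
  exact: (magnus_mexpM_lt (complete_abs_complex R)).
have cR := complete_abs_real R; have cC := complete_abs_complex R.
split=> A B.
  by rewrite [A + B]thinmx0 [A]thinmx0 [B]thinmx0 (opnorm20 cR) addr0 ltxx.
by rewrite [A + B]thinmx0 [A]thinmx0 [B]thinmx0 (opnorm20 cC) addr0 ltxx.
Qed.
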